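(* If $X$ is a co-existentially closed continuum, then the first integral Čech cohomology group $\check{H}^1(X)$ is a torsion-free divisible abelian group.
   Context: A continuum is a connected compact Hausdorff space. $C(X)$ denotes the C*-algebra of continuous complex-valued functions on $X$. $T_{\mathrm{conn}}$ denotes a theory of continuous first-order logic in the language of unital C*-algebras whose models are exactly the C*-algebras isomorphic to $C(X)$ for some continuum $X$. A model $M \models T_{\mathrm{conn}}$ is existentially closed if for every $N \models T_{\mathrm{conn}}$ with $M \subseteq N$, every quantifier-free formula $\phi(\overline{x},\overline{y})$ and every tuple $\overline{b}$ from $M$, $(\inf_{\overline{x}}\phi(\overline{x},\overline{b}))^M = (\inf_{\overline{x}}\phi(\overline{x},\overline{b}))^N$. A continuum $X$ is co-existentially closed if $C(X)$ is an existentially closed model of $T_{\mathrm{conn}}$. $\check{H}^1(X)$ can be identified with the group of homotopy classes of continuous maps $X \to \mathbb{T}$ (pointwise multiplication), where $\mathbb{T}$ is the unit circle in $\mathbb{C}$. *)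

(* Defs.v *)
From HB Require Import structures.
From mathcomp Require Import all_boot all_order all_algebra.
From mathcomp Require Import generic_quotient.
From mathcomp Require Import complex.
From mathcomp Require Import all_classical all_reals topology normedtype.

Set Implicit Arguments.
Unset Strict Implicit.
Unset Printing Implicit Defensive.

Import Order.TTheory GRing.Theory Num.Theory.
Import numFieldNormedType.Exports.

Local Open Scope classical_set_scope.
Local Open Scope ring_scope.
Local Open Scope complex_scope.

(* The topology on the complex numbers is found by inference on R[i]^o, not on
   R[i]. The norm `|z| of z : R[i] is itself an element of R[i], hence the real
   parts taken in cfun_norm below. *)

(* The library's connected holds of set0, so the empty space is admitted; all
   notions below are trivial for it. *)
Definition continuum (X : topologicalType) : Prop :=
  [/\ connected [set: X], compact [set: X] & hausdorff_space X].

(* Structures interpreting the symbols of the language of unital C*-algebras.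
   The C*-axioms are not recorded: they follow from models_Tconn. *)
Record cstar_structure (R : realType) := CStarStructure {
  cs_sort :> Type;
  cs_zero : cs_sort;
  cs_one : cs_sort;
  cs_add : cs_sort -> cs_sort -> cs_sort;
  cs_mul : cs_sort -> cs_sort -> cs_sort;
  cs_scale : R[i] -> cs_sort -> cs_sort;
  cs_star : cs_sort -> cs_sort;
  cs_norm : cs_sort -> R
}.

Arguments cs_zero {R} c.
Arguments cs_one {R} c.

Record is_embedding (R : realType) (A B : cstar_structure R) (h : A -> B) :
    Prop := IsEmbedding {
  emb_zero : h (cs_zero A) = cs_zero B;
  emb_one : h (cs_one A) = cs_one B;
  emb_add : forall a b, h (cs_add a b) = cs_add (h a) (h b);
  emb_mul : forall a b, h (cs_mul a b) = cs_mul (h a) (h b);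
  emb_scale : forall (c : R[i]) a, h (cs_scale c a) = cs_scale c (h a);
  emb_star : forall a, h (cs_star a) = cs_star (h a);
  emb_norm : forall a, cs_norm (h a) = cs_norm a
}.

Definition isomorphic (R : realType) (A B : cstar_structure R) : Prop :=
  exists2 h : A -> B, is_embedding h & bijective h.

Section ContinuousFunctions.
Variables (R : realType) (X : topologicalType).
Local Notation CX := (continuousType X R[i]^o).
Implicit Types f g : CX.

Lemma continuous_conjc : continuous (fun z : R[i]^o => (z^* : R[i]^o)).
Proof.
move=> z U /nbhs_ballP[e /= e0 eU]; apply/nbhs_ballP; exists e => //= w.
rewrite -!ball_normE /ball_/= => zw; apply: eU; rewrite -ball_normE /ball_/=.
rewrite (_ : z^* - w^* = (z - w)^*) ?normcJ//.
by rewrite (rmorphB (@conjc R)).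
Qed.

Lemma cfun_cst_continuous (c : R[i]) : continuous (fun _ : X => c : R[i]^o).
Proof. by move=> x; exact: cvg_cst. Qed.

Lemma cfun_add_continuous f g : continuous (fun x => f x + g x : R[i]^o).
Proof. by move=> x; apply: cvgD; exact: cts_fun. Qed.

Lemma cfun_mul_continuous f g : continuous (fun x => f x * g x : R[i]^o).
Proof. by move=> x; apply: cvgM; exact: cts_fun. Qed.

Lemma cfun_scale_continuous (c : R[i]) f :
  continuous (fun x => c * f x : R[i]^o).
Proof.
by move=> x; apply: (@cvgM R[i]); [exact: cvg_cst|exact: cts_fun].
Qed.

Lemma cfun_star_continuous f : continuous (fun x => (f x)^* : R[i]^o).
Proof.
move=> x; apply: (@continuous_comp _ R[i]^o R[i]^o f (fun z => z^*)).
  exact: cts_fun.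
exact: continuous_conjc.
Qed.

Definition cfun_norm f : R := sup (range (fun x => complex.Re `|f x|)).

Definition cfun_algebra : cstar_structure R := {|
  cs_sort := CX;
  cs_zero := @mkcts _ _ _ (@cfun_cst_continuous 0);
  cs_one := @mkcts _ _ _ (@cfun_cst_continuous 1);
  cs_add := fun f g => @mkcts _ _ _ (@cfun_add_continuous f g);
  cs_mul := fun f g => @mkcts _ _ _ (@cfun_mul_continuous f g);
  cs_scale := fun c f => @mkcts _ _ _ (@cfun_scale_continuous c f);
  cs_star := fun f => @mkcts _ _ _ (@cfun_star_continuous f);
  cs_norm := cfun_norm
|}.

End ContinuousFunctions.

Definition models_Tconn (R : realType) (A : cstar_structure R) : Prop :=
  exists2 Y : topologicalType, continuum Y & isomorphic A (cfun_algebra R Y).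

Section Formulas.
Variable R : realType.

Inductive cs_term (V : Type) : Type :=
| TVar of V
| TZero
| TOne
| TAdd of cs_term V & cs_term V
| TMul of cs_term V & cs_term V
| TScale of R[i] & cs_term V
| TStar of cs_term V.

(* The atomic formulas are the norms of terms; the metric of the language is
   recovered as d(s, t) = || s - t ||. Connectives are all continuous functions
   from R^k to R. *)
Inductive qf_formula (V : Type) : Type :=
| QNorm of cs_term V
| QConn (k : nat) (u : 'rV[R]_k -> R) of
    continuous u & ('I_k -> qf_formula V).

Variable A : cstar_structure R.

Fixpoint term_eval (V : Type) (e : V -> A) (t : cs_term V) : A :=
  match t with
  | TVar v => e v
  | TZero => cs_zero A
  | TOne => cs_one A
  | TAdd s t => cs_add (term_eval e s) (term_eval e t)
  | TMul s t => cs_mul (term_eval e s) (term_eval e t)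
  | TScale c t => cs_scale c (term_eval e t)
  | TStar t => cs_star (term_eval e t)
  end.

Fixpoint qf_eval (V : Type) (e : V -> A) (phi : qf_formula V) : R :=
  match phi with
  | QNorm t => cs_norm (term_eval e t)
  | QConn k u _ phis => u (\row_(i < k) qf_eval e (phis i))
  end.

Definition assign (k m : nat) (a : 'I_k -> A) (b : 'I_m -> A)
    (v : 'I_k + 'I_m) : A :=
  match v with inl i => a i | inr j => b j end.

(* The domains of quantification for C*-algebras are the closed balls of
   integer radius; each quantified variable x_i ranges over the ball of
   radius r i. On these balls phi is bounded, so that inf is the actual
   infimum. *)
Definition inf_eval (k m : nat) (r : 'I_k -> nat)
    (phi : qf_formula ('I_k + 'I_m)) (b : 'I_m -> A) : R :=
  inf [set qf_eval (assign a b) phi |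
       a in [set a : 'I_k -> A | forall i, cs_norm (a i) <= (r i)%:R]].

End Formulas.

Definition existentially_closed (R : realType) (M : cstar_structure R) : Prop :=
  models_Tconn M /\
  forall (N : cstar_structure R) (h : M -> N),
    models_Tconn N -> is_embedding h ->
    forall (k m : nat) (r : 'I_k -> nat) (phi : qf_formula R ('I_k + 'I_m))
      (b : 'I_m -> M),
    inf_eval r phi b = inf_eval r phi (h \o b).

Definition coexistentially_closed (R : realType) (X : topologicalType) : Prop :=
  continuum X /\ existentially_closed (cfun_algebra R X).

Section Circle.
Variable R : realType.

Definition circle : set R[i]^o := [set z | `|z| = 1].

Lemma circle_norm (z : circle) : `|\val z| = 1.
Proof. exact: (set_mem (valP z)). Qed.

Lemma circle1_subproof : (1 : R[i]^o) \in circle.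
Proof. by apply/mem_set; rewrite /circle/= normr1. Qed.

Lemma circleM_subproof (z w : circle) : (\val z * \val w : R[i]^o) \in circle.
Proof. by apply/mem_set; rewrite /circle/= normrM !circle_norm mulr1. Qed.

Lemma circleV_subproof (z : circle) : ((\val z)^-1 : R[i]^o) \in circle.
Proof. by apply/mem_set; rewrite /circle/= normfV circle_norm invr1. Qed.

Definition circle1 : circle :=
  exist (fun x => x \in circle) _ circle1_subproof.
Definition circleM (z w : circle) : circle :=
  exist (fun x => x \in circle) _ (circleM_subproof z w).
Definition circleV (z : circle) : circle :=
  exist (fun x => x \in circle) _ (circleV_subproof z).

Lemma continuous_circle (T : topologicalType) (f : T -> circle) :
  continuous (fun t => \val (f t) : R[i]^o) -> continuous f.
Proof. by move=> cf; apply: continuous_comp_initial; exact: cf. Qed.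

Lemma continuous_circle_val : continuous (fun z : circle => \val z : R[i]^o).
Proof. exact: initial_continuous. Qed.

Lemma circleM_continuous (T : topologicalType) (f g : T -> circle) :
  continuous f -> continuous g -> continuous (fun t => circleM (f t) (g t)).
Proof.
move=> cf cg; apply: continuous_circle => t /=.
apply: cvgM; apply: continuous_comp; first [exact: cf|exact: cg
  |exact: continuous_circle_val].
Qed.

Lemma circleV_continuous (T : topologicalType) (f : T -> circle) :
  continuous f -> continuous (fun t => circleV (f t)).
Proof.
move=> cf; apply: continuous_circle => t /=; apply: cvgV.
  by rewrite -normr_eq0 circle_norm oner_eq0.
by apply: continuous_comp; [exact: cf|exact: continuous_circle_val].
Qed.

End Circle.

Arguments circle R : clear implicits.
Arguments circle1 R : clear implicits.

Section H1.
Variables (R : realType) (X : topologicalType).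
Local Notation map := (continuousType X (circle R)).
Local Notation cylinder := [set p : X * R | 0 <= p.2 <= 1].
Implicit Types f g h : map.

(* The values of H outside of the cylinder are irrelevant. *)
Definition homotopic f g : Prop :=
  exists H : X * R -> circle R,
    [/\ {within cylinder, continuous H},
        forall x, H (x, 0) = f x & forall x, H (x, 1) = g x].

Lemma within_comp (A B : set (X * R)) (H : X * R -> circle R)
    (phi : X * R -> X * R) :
  continuous phi -> (forall p, A p -> B (phi p)) ->
  {within B, continuous H} -> {within A, continuous (H \o phi)}.
Proof.
move=> cphi AB /subspace_continuousP cH; apply/subspace_continuousP => p Ap.
move=> U nU; change (nbhs p (fun q => A q -> U (H (phi q)))).
have nB : nbhs (phi p) (fun q => B q -> U (H q)) := cH _ (AB _ Ap) U nU.
apply: (@filterS _ (nbhs p) (nbhs_filter p) _ _ _ (cphi p _ nB)) => q /= BU /AB.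
exact: BU.
Qed.

Lemma cylinder_affine_continuous (a b : R) :
  continuous (fun p : X * R => (p.1, a * p.2 + b)).
Proof.
move=> p; apply: (@cvg_pair _ _ _ _ (nbhs p.1) (nbhs (a * p.2 + b))); first exact: cvg_fst.
by apply: cvgD; [apply: cvgM; [exact: cvg_cst|exact: cvg_snd]|exact: cvg_cst].
Qed.

Lemma homotopic_refl f : homotopic f f.
Proof.
exists (f \o fst); split => //; apply: continuous_subspaceT => p.
by apply: continuous_comp; [exact: cvg_fst|exact: cts_fun].
Qed.

Lemma homotopic_sym f g : homotopic f g -> homotopic g f.
Proof.
move=> [H [cH H0 H1]].
exists (H \o (fun p => (p.1, -1 * p.2 + 1))); split => [|x|x] /=.
- apply: within_comp cH; first exact: cylinder_affine_continuous.
  by move=> p /= /andP[p0 p1]; rewrite mulN1r addrC subr_ge0 p1/= gerBl.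
- by rewrite mulr0 add0r.
- by rewrite mulr1 addNr.
Qed.

Lemma homotopic_trans f g h : homotopic f g -> homotopic g h -> homotopic f h.
Proof.
move=> [H [cH H0 H1]] [K [cK K0 K1]].
pose L (p : X * R) : circle R :=
  if p.2 <= 2^-1 then H (p.1, 2 * p.2 + 0) else K (p.1, 2 * p.2 + -1).
exists L; split; last 2 first.
- by move=> x; rewrite /L/= invr_ge0 ler0n mulr0 addr0.
- move=> x; rewrite /L/= leNgt invf_lt1 ?ltr0n// ltr1n/= mulr1.
  by rewrite -K1; congr (K (_, _)); rewrite -natr1 addrK.
pose A := [set p : X * R | 0 <= p.2 <= 2^-1].
pose B := [set p : X * R | 2^-1 <= p.2 <= 1].
have csnd : continuous (snd : X * R -> R) by move=> ?; exact: cvg_snd.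
have half1 : 2^-1 <= 1 :> R by rewrite invf_le1 ?ltr0n// ler1n.
have half0 : 0 <= 2^-1 :> R by rewrite invr_ge0 ler0n.
have two0 : 0 < 2 :> R by rewrite ltr0n.
have clI (a b : R) : closed [set p : X * R | a <= p.2 <= b].
  rewrite (_ : [set p | _] = snd @^-1` [set` `[a, b]]).
    by apply: preimage_closed => //; exact: interval_closed.
  by apply/seteqP; split => p /=; rewrite in_itv.
have -> : cylinder = A `|` B.
  apply/seteqP; split => p /=; rewrite /A /B/=.
    by move=> /andP[p0 p1]; case: (leP p.2 2^-1) => p2; [left|right];
      rewrite ?p0 ?p1 ?andbT //= ltW.
  by move=> [|] /andP[pa pb]; rewrite ?pa ?pb ?andbT /= ?(le_trans pb) ?(le_trans _ pa).
apply: withinU_continuous; [exact: clI|exact: clI| |].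
- apply: (@subspace_eq_continuous _ _ _ (H \o (fun p => (p.1, 2 * p.2 + 0)))).
    by move=> p; rewrite inE => /andP[_ p2]; rewrite /from_subspace /L ifT.
  apply: within_comp cH; first exact: cylinder_affine_continuous.
  move=> p /= /andP[p0 p1]; rewrite addr0; apply/andP; split.
    by rewrite mulr_ge0// ltW.
  by rewrite mulrC -ler_pdivlMr// mul1r.
- apply: (@subspace_eq_continuous _ _ _ (K \o (fun p => (p.1, 2 * p.2 + -1)))).
    move=> p; rewrite inE => /andP[p0 p1]; rewrite /from_subspace /L /=; case: ifPn => // p2.
    have -> : p.2 = 2^-1 by apply/le_anti; rewrite p2.
    by rewrite divff ?gt_eqF// subrr addr0 K0 H1.
  apply: within_comp cK; first exact: cylinder_affine_continuous.
  move=> p /= /andP[p0 p1]; apply/andP; split.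
    by rewrite subr_ge0 mulrC -ler_pdivrMr// mul1r.
  by rewrite lerBlDr (_ : 1 + 1 = 2)// ger_pMr.
Qed.

Lemma mapM_continuous f g : continuous (fun x => circleM (f x) (g x)).
Proof. by apply: circleM_continuous; exact: cts_fun. Qed.

Lemma mapV_continuous f : continuous (fun x => circleV (f x)).
Proof. by apply: circleV_continuous; exact: cts_fun. Qed.

Lemma map1_continuous : continuous (fun _ : X => circle1 R).
Proof. by move=> x; exact: cvg_cst. Qed.

Definition mapM f g : map := @mkcts _ _ _ (@mapM_continuous f g).
Definition mapV f : map := @mkcts _ _ _ (@mapV_continuous f).
Definition map1 : map := @mkcts _ _ _ (@map1_continuous).

Lemma homotopicM f f' g g' :
  homotopic f f' -> homotopic g g' -> homotopic (mapM f g) (mapM f' g').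
Proof.
move=> [H [cH H0 H1]] [K [cK K0 K1]].
exists (fun p => circleM (H p) (K p)); split => [|x|x].
- exact: (@circleM_continuous R (subspace _)).
- by rewrite H0 K0.
- by rewrite H1 K1.
Qed.

Lemma homotopicV f f' : homotopic f f' -> homotopic (mapV f) (mapV f').
Proof.
move=> [H [cH H0 H1]]; exists (fun p => circleV (H p)); split => [|x|x].
- exact: (@circleV_continuous R (subspace _)).
- by rewrite H0.
- by rewrite H1.
Qed.

Definition homotopicb f g : bool := `[< homotopic f g >].

Lemma homotopicb_refl : reflexive homotopicb.
Proof. by move=> f; apply/asboolP; exact: homotopic_refl. Qed.

Lemma homotopicb_sym : symmetric homotopicb.
Proof.
by move=> f g; apply/idP/idP => /asboolP fg; apply/asboolP;
  exact: homotopic_sym.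
Qed.

Lemma homotopicb_trans : transitive homotopicb.
Proof.
move=> g f h /asboolP fg /asboolP gh; apply/asboolP.
exact: homotopic_trans fg gh.
Qed.

Definition homotopy_rel :=
  EquivRel homotopicb homotopicb_refl homotopicb_sym homotopicb_trans.

Local Open Scope quotient_scope.

(* The first integral Cech cohomology group of X, as the group [X, T] of
   homotopy classes of maps to the circle T. The group law, induced by the
   pointwise multiplication of maps, is written additively. *)
Definition cech_H1 := {eq_quot homotopy_rel}.

HB.instance Definition _ := Choice.on cech_H1.
HB.instance Definition _ := EqQuotient.on cech_H1.

Definition H1_class f : cech_H1 := \pi_cech_H1 f.

Definition H1_zero : cech_H1 := H1_class map1.
Definition H1_opp (a : cech_H1) : cech_H1 := H1_class (mapV (repr a)).
Definition H1_add (a b : cech_H1) : cech_H1 :=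
  H1_class (mapM (repr a) (repr b)).

Lemma H1_classP f g : H1_class f = H1_class g <-> homotopic f g.
Proof.
split; first by move=> /eqmodP /asboolP.
by move=> fg; apply/eqmodP/asboolP.
Qed.

Lemma H1_repr f : homotopic (repr (H1_class f)) f.
Proof. by apply/H1_classP; rewrite /H1_class reprK. Qed.

Lemma H1_ind (P : cech_H1 -> Prop) : (forall f, P (H1_class f)) -> forall a, P a.
Proof. by move=> Pf a; rewrite -[a]reprK; exact: Pf. Qed.

Lemma H1_addE f g : H1_add (H1_class f) (H1_class g) = H1_class (mapM f g).
Proof. by apply/H1_classP/homotopicM; exact: H1_repr. Qed.

Lemma H1_oppE f : H1_opp (H1_class f) = H1_class (mapV f).
Proof. by apply/H1_classP/homotopicV; exact: H1_repr. Qed.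

Lemma H1_addA : associative H1_add.
Proof.
elim/H1_ind => f; elim/H1_ind => g; elim/H1_ind => h; rewrite !H1_addE.
by congr H1_class; apply/continuousEP => x; apply/val_inj; rewrite /= mulrA.
Qed.

Lemma H1_addC : commutative H1_add.
Proof.
elim/H1_ind => f; elim/H1_ind => g; rewrite !H1_addE.
by congr H1_class; apply/continuousEP => x; apply/val_inj; rewrite /= mulrC.
Qed.

Lemma H1_add0 : left_id H1_zero H1_add.
Proof.
elim/H1_ind => f; rewrite H1_addE.
by congr H1_class; apply/continuousEP => x; apply/val_inj; rewrite /= mul1r.
Qed.

Lemma H1_addN : left_inverse H1_zero H1_opp H1_add.
Proof.
elim/H1_ind => f; rewrite H1_oppE H1_addE.
congr H1_class; apply/continuousEP => x; apply/val_inj; rewrite /= mulVf//.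
by rewrite -normr_eq0 circle_norm oner_eq0.
Qed.

HB.instance Definition _ :=
  GRing.isZmodule.Build cech_H1 H1_addA H1_addC H1_add0 H1_addN.

End H1.

Definition torsion_free (V : zmodType) : Prop :=
  forall (n : nat) (x : V), (0 < n)%N -> x *+ n = 0 -> x = 0.

Definition divisible (V : zmodType) : Prop :=
  forall (n : nat) (x : V), (0 < n)%N -> exists y : V, y *+ n = x.

(* Main.v *)
Require Import Defs.
From mathcomp Require Import all_boot all_order all_algebra.
From mathcomp Require Import complex.
From mathcomp Require Import all_classical all_reals topology normedtype.
From mathcomp Require Import trigo.

(** Torsion-freeness holds for every continuum. If [f ^ n] is null-homotopic,
    it is a product of finitely many maps close to [1], each of which has a
    null-homotopic [n]-th root, so [f ^ n = r ^ n] with [r] null-homotopic; as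
    [X] is connected, [f / r] is a constant root of unity.

    For divisibility, given [f : X -> T], the [n]-fold covering
    [{(x, z) | z ^ n = f x}] of [X] has a nonempty clopen part [V] that is
    connected: one with as few points as possible over a fixed [x0]. It maps
    onto [X], so [C(X)] embeds in [C(V)], where [f] has an [n]-th root. By
    existential closedness some [a] in [C(X)] satisfies [|a ^ n - f| < 1], and
    [a / |a|] is then an [n]-th root of [f] up to homotopy. *)

Set Implicit Arguments.
Unset Strict Implicit.
Unset Printing Implicit Defensive.

Import Order.TTheory GRing.Theory Num.Theory.
Import numFieldNormedType.Exports.

Local Open Scope classical_set_scope.
Local Open Scope ring_scope.
Local Open Scope complex_scope.

(** * Topology of the complex plane and of the circle *)

Section ComplexTopology.
Variable R : realType.
Local Notation C := R[i]^o.

Lemma normc_real (z : R[i]) : `|z| = (complex.Re `|z|)%:C.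
Proof. by rewrite normc_def. Qed.

Lemma Re_norm_le (z : R[i]) : `|complex.Re z| <= complex.Re `|z|.
Proof. by have := normc_ge_Re z; rewrite [X in _ <= X]normc_real lecR. Qed.

(** Reduces to the bound on real parts: multiplication by ['i] turns the imaginary part into a real
    part up to sign and preserves the norm. *)
Lemma Im_norm_le (z : R[i]) : `|complex.Im z| <= complex.Re `|z|.
Proof.
have := Re_norm_le (z * 'i); rewrite ReiNIm normrN normrM.
suff -> : `|'i : R[i]| = 1 by rewrite mulr1.
by rewrite normc_def/= expr0n/= expr1n add0r sqrtr1.
Qed.

Lemma continuous_Re : continuous (fun z : C => complex.Re z : R).
Proof.
move=> z U /nbhs_ballP[e /= e0 eU]; apply/nbhs_ballP; exists e%:C => /=.
  by rewrite ltcR.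
move=> w; rewrite -ball_normE /ball_/= => zw; apply: eU.
rewrite -ball_normE /ball_/= -raddfB/=.
by rewrite (le_lt_trans (Re_norm_le _))// -ltcR -normc_real.
Qed.

Lemma continuous_Im : continuous (fun z : C => complex.Im z : R).
Proof.
move=> z U /nbhs_ballP[e /= e0 eU]; apply/nbhs_ballP; exists e%:C => /=.
  by rewrite ltcR.
move=> w; rewrite -ball_normE /ball_/= => zw; apply: eU.
rewrite -ball_normE /ball_/= -raddfB/=.
by rewrite (le_lt_trans (Im_norm_le _))// -ltcR -normc_real.
Qed.

Lemma continuous_real_complex : continuous (fun x : R => x%:C : C).
Proof.
move=> x U /nbhs_ballP[e /= e0 eU]; apply/nbhs_ballP.
(* The radius [e] lives in [R[i]], but [0 < e] forces its imaginary part to vanish, so its real part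
   is the same radius. *)
exists (complex.Re e) => /=.
  by move: e0; rewrite ltcE => /andP[].
move=> y; rewrite -ball_normE /ball_/= => xy; apply: eU.
rewrite -ball_normE /ball_/= -rmorphB/= normc_def/= expr0n/= addr0 sqrtr_sqr.
by move: e0; rewrite !ltcE => /andP[/eqP -> _] /=; rewrite eqxx.
Qed.

Lemma cvg_complex (T : Type) (F : set_system T) (FF : Filter F)
    (a b : T -> R) (x y : R) :
  a t @[t --> F] --> x -> b t @[t --> F] --> y ->
  (a t +i* b t : C) @[t --> F] --> (x +i* y : C).
Proof.
move=> ax by_.
have E u v : u +i* v = u%:C + 'i * v%:C :> C by rewrite [LHS]complexE.
rewrite E; under eq_fun do rewrite E.
apply: cvgD; first exact: (cvg_comp _ _ ax (@continuous_real_complex x)).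
apply: cvgM; first exact: cvg_cst.
exact: (cvg_comp _ _ by_ (@continuous_real_complex y)).
Qed.

Lemma closed_complex1 (c : C) : closed [set c].
Proof.
exact/accessible_closed_set1/hausdorff_accessible/norm_hausdorff.
Qed.

(** The circle is closed and contained in the image of the compact square with sides [-1, 1]. *)
Lemma circle_compact : compact (circle R).
Proof.
pose I : set R := `[-1, 1]%classic.
have cI : compact I by exact: segment_compact.
pose phi (p : R * R) : C := p.1 +i* p.2.
have cphi : continuous phi.
  by move=> p; apply: cvg_complex; [exact: cvg_fst|exact: cvg_snd].
have cK : compact (phi @` (I `*` I)).
  apply: continuous_compact; last exact: compact_setX.
  exact: continuous_subspaceT.
apply: subclosed_compact cK _.
- rewrite (_ : circle R = (fun z : C => complex.Re `|z| : R) @^-1` [set 1]).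
    apply: preimage_closed; last first.
      exact/accessible_closed_set1/hausdorff_accessible/Rhausdorff.
    move=> z _; apply: (@continuous_comp _ C R (fun z => `|z|) (@complex.Re R)).
      exact: norm_continuous.
    exact: continuous_Re.
  apply/seteqP; split => z; first by move/(congr1 (@complex.Re R)).
  by move=> z1; have := normc_real z; rewrite [complex.Re _]z1.
- move=> z z1; exists (complex.Re z, complex.Im z); last by case: z {z1}.
  rewrite /I; split => /=; rewrite in_itv/= -ler_norml.
    by rewrite (le_trans (Re_norm_le _))// (congr1 (@complex.Re R) z1).
  by rewrite (le_trans (Im_norm_le _))// (congr1 (@complex.Re R) z1).
Qed.

Lemma cvgX (T : Type) (F : set_system T) (FF : Filter F)
    (f : T -> C) (a : C) n :
  f t @[t --> F] --> a -> ((f t) ^+ n : C) @[t --> F] --> (a ^+ n : C).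
Proof.
move=> fa; elim: n => [|n IH].
  by rewrite expr0; under eq_fun do rewrite expr0; exact: cvg_cst.
by rewrite exprS; under eq_fun do rewrite exprS; exact: cvgM.
Qed.

End ComplexTopology.

(** * The principal n-th root near 1 *)

Section NthRoot.
Variable R : realType.
Local Notation C := R[i]^o.
Implicit Types (t : R) (w z : R[i]) (n : nat).

Lemma cisX t n : (cos t +i* sin t) ^+ n = cos (t *+ n) +i* sin (t *+ n).
Proof.
elim: n => [|n IH]; first by rewrite expr0 mulr0n cos0 sin0.
rewrite exprS IH mulrS cosD sinD; apply/eqP; rewrite eq_complex/=.
by rewrite eqxx addrC eqxx.
Qed.

(** For unit [w] in the right half-plane the arctangent is the argument of [w], and this is the
    principal root. The value has modulus 1 for every [w]. *)
Definition nroot n w : R[i] :=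
  let t := atan (complex.Im w / complex.Re w) / n%:R in cos t +i* sin t.

Lemma nroot_norm n w : `|nroot n w| = 1.
Proof. by rewrite normc_def/= cos2Dsin2 sqrtr1. Qed.

Lemma nroot1 n : nroot n 1 = 1.
Proof. by rewrite /nroot/= mul0r atan0 mul0r cos0 sin0. Qed.

Lemma nroot_Re_gt0 n w : (0 < n)%N -> 0 < complex.Re (nroot n w).
Proof.
move=> n0 /=; apply: cos_gt0_pihalf; rewrite -ltr_norml normrM normfV.
set a := atan _; rewrite (@le_lt_trans _ _ `|a|)//; last first.
  by rewrite ltr_norml atan_gtNpi2 atan_ltpi2.
case: n n0 => // n _; rewrite normr_nat; apply: ler_piMr => //.
by rewrite invf_le1 ?ltr0n ?ler1n.
Qed.

(** By de Moivre it suffices that [atan q] is an argument of [w]; its cosine is [Re w] because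
    [1 + q ^ 2] is the inverse square of [Re w] when [w] has modulus 1. *)
Lemma nrootX n w : (0 < n)%N -> `|w| = 1 -> 0 < complex.Re w ->
  nroot n w ^+ n = w.
Proof.
move=> n0 w1 Rew; rewrite /nroot; set q := complex.Im w / complex.Re w.
rewrite cisX -[_ *+ n]mulr_natr divfK ?pnatr_eq0 -?lt0n//.
have cosq : cos (atan q) = complex.Re w.
  have := add_Re2_Im2 w; rewrite w1 expr1n => /complexI h.
  rewrite cos_atan (_ : 1 + q ^+ 2 = (complex.Re w)^-1 ^+ 2).
    by rewrite sqrtr_sqr ger0_norm ?invrK// invr_ge0 ltW.
  rewrite /q expr_div_n exprVn -[RHS]mul1r -[X in _ = X * _]h mulrDl divff//.
  by rewrite expf_neq0// gt_eqF.
have -> : sin (atan q) = complex.Im w.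
  have := atanK q; rewrite /tan cosq => /(congr1 ( *%R^~ (complex.Re w))).
  by rewrite /q !divfK// gt_eqF.
by rewrite cosq; case: (w).
Qed.

Lemma cvg_nroot (T : Type) (F : set_system T) (FF : Filter F) (f : T -> C)
    n (w : C) : complex.Re w != 0 ->
  f t @[t --> F] --> w -> (nroot n (f t) : C) @[t --> F] --> (nroot n w : C).
Proof.
move=> Rew fw.
have cq : (complex.Im (f t) / complex.Re (f t) : R) @[t --> F] -->
    (complex.Im w / complex.Re w : R).
  apply: cvgM; first exact: (cvg_comp _ _ fw (@continuous_Im R w)).
  by apply: cvgV => //; exact: (cvg_comp _ _ fw (@continuous_Re R w)).
have ct : (atan (complex.Im (f t) / complex.Re (f t)) / n%:R : R) @[t --> F] -->
    (atan (complex.Im w / complex.Re w) / n%:R : R).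
  apply: cvgM; last exact: cvg_cst.
  exact: (cvg_comp _ _ cq (@continuous_atan R _)).
apply: cvg_complex.
- exact: (cvg_comp _ _ ct (@continuous_cos R _)).
- exact: (cvg_comp _ _ ct (@continuous_sin R _)).
Qed.

Lemma Re_gt0_near1 w : `|w - 1| < 1 -> 0 < complex.Re w.
Proof.
move=> w1; have : `|complex.Re (w - 1)| < 1.
  by rewrite (le_lt_trans (Re_norm_le _))// -ltcR -normc_real.
by rewrite raddfB/= ltr_norml => /andP[+ _]; rewrite ltrBrDl subrr.
Qed.

End NthRoot.

(** * Homotopies between maps to the circle *)

Section CircleMaps.
Variables (R : realType) (X : topologicalType).
Local Notation C := R[i]^o.
Local Notation map := (continuousType X (circle R)).
Implicit Types f g : map.

Lemma map_val_continuous f : continuous (fun x => \val (f x) : C).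
Proof.
move=> x; apply: (@continuous_comp _ (circle R) C f); first exact: cts_fun.
exact: continuous_circle_val.
Qed.

Lemma map_val_neq0 f x : \val (f x) != 0 :> R[i].
Proof. by rewrite -normr_eq0 circle_norm oner_eq0. Qed.

(** Radial projection of the punctured plane; at 0 it takes the default value 1. *)
Definition direction (z : C) : circle R :=
  insubd (circle1 R) (z / `|z| : C).

Lemma val_direction (z : C) : z != 0 -> \val (direction z) = z / `|z|.
Proof.
move=> z0; rewrite /direction val_insubd ifT//.
by apply/mem_set; rewrite /circle/= normrM normfV normr_id divff// normr_eq0.
Qed.

Lemma direction_circle (z : circle R) : direction (\val z) = z.
Proof.
apply/val_inj; rewrite val_direction ?circle_norm ?divr1//.
by rewrite -normr_eq0 circle_norm oner_eq0.
Qed.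

Lemma direction_continuous (T : topologicalType) (u : T -> C) :
  continuous u -> (forall t, u t != 0) -> continuous (direction \o u).
Proof.
move=> cu u0; apply: continuous_circle.
rewrite (_ : (fun t => _) = (fun t => u t / `|u t|)); last first.
  by apply/funext => t; exact: val_direction.
move=> t; apply: cvgM; first exact: cu.
apply: cvgV; first by rewrite normr_eq0.
by apply: cvg_norm; exact: cu.
Qed.

(** Retraction of the line onto [0, 1], through which homotopies are made continuous on all of
    [X * R]. *)
Definition clamp (t : R) : R := Num.max 0 (Num.min 1 t).

Lemma clamp_continuous : continuous clamp.
Proof.
move=> t; apply: continuous_max; first exact: cvg_cst.
by apply: continuous_min; [exact: cvg_cst|exact: cvg_id].
Qed.

Lemma clamp_itv t : 0 <= clamp t <= 1.
Proof. by rewrite /clamp le_max lexx ge_max ler01 ge_min lexx. Qed.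

Lemma clamp0 : clamp 0 = 0.
Proof. by rewrite /clamp min_r// maxxx. Qed.

Lemma clamp1 : clamp 1 = 1.
Proof. by rewrite /clamp minxx max_r. Qed.

(** The segment from [f x] to [g x] avoids 0, so it can be projected radially to the circle. *)
Lemma homotopic_antipodal f g :
  (forall x, \val (f x) + \val (g x) != 0 :> R[i]) -> homotopic f g.
Proof.
move=> fg.
pose u (p : X * R) : C :=
  (1 - clamp p.2)%:C * \val (f p.1) + (clamp p.2)%:C * \val (g p.1).
have cC (a : R -> R) : continuous a ->
    continuous (fun p : X * R => (a p.2)%:C : C).
  move=> ca p; apply: (@continuous_comp _ R C (fun p : X * R => a p.2)).
    by apply: continuous_comp; [exact: cvg_snd|exact: ca].
  exact: continuous_real_complex.
have cf h : continuous (fun p : X * R => \val ((h : map) p.1) : C).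
  by move=> p; apply: (@continuous_comp _ X C fst (fun x => \val (h x)));
    [exact: cvg_fst|exact: map_val_continuous].
have cu : continuous u.
  move=> p; apply: cvgD; apply: cvgM; [|exact: cf| |exact: cf].
    apply: (cC (fun t => 1 - clamp t)) => t.
    by apply: cvgB; [exact: cvg_cst|exact: clamp_continuous].
  exact/cC/clamp_continuous.
(* If the combination vanished, comparing moduli would give equal weights [1 - t = t], and
   cancelling them would make the two values antipodal. *)
have u0 p : u p != 0.
  apply/eqP => up0; have /andP[t0 t1] := clamp_itv p.2.
  have e : (1 - clamp p.2)%:C * \val (f p.1) =
      - ((clamp p.2)%:C * \val (g p.1)).
    by apply/eqP; rewrite -addr_eq0 -[X in X == _]/(u p) up0.
  have : 1 - clamp p.2 = clamp p.2.
    have /(congr1 Num.norm) := e.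
    rewrite normrN !normrM !circle_norm !mulr1 !ger0_norm ?ler0c ?subr_ge0//.
    exact: complexI.
  move=> t; move: e; rewrite t -mulrN => /mulfI e.
  have /eqP := fg p.1; apply; rewrite e ?addNr//.
  apply/eqP => /complexI c0; move: t; rewrite c0 subr0 => /eqP.
  by rewrite oner_eq0.
exists (direction \o u); split => [|x|x].
- exact/continuous_subspaceT/direction_continuous.
- by rewrite /= /u/= clamp0 subr0 mul1r mul0r addr0 direction_circle.
- by rewrite /= /u/= clamp1 subrr mul1r mul0r add0r direction_circle.
Qed.

Definition mapX f n : map := iter n (mapM f) (map1 R X).

Lemma val_mapX f n x : \val (mapX f n x) = \val (f x) ^+ n :> R[i].
Proof. by elim: n => [|n IH]//=; rewrite exprS -IH. Qed.

Lemma H1_class_mulrn f n : H1_class f *+ n = H1_class (mapX f n).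
Proof.
elim: n => [|n IH]; first by rewrite mulr0n.
by rewrite mulrS IH [LHS]H1_addE.
Qed.

Definition map_cst (c : circle R) : map :=
  @mkcts _ _ (fun=> c) (fun x => cvg_cst c).

(** Only -1 is antipodal to 1, and it is the square of ['i], which is not. *)
Lemma homotopic_cst (c : circle R) : homotopic (map_cst c) (map1 R X).
Proof.
have [cN|cN] := eqVneq (\val c : R[i]) (- 1); last first.
  by apply: homotopic_antipodal => x /=; rewrite addr_eq0.
have i1 : ('i : C) \in circle R.
  by apply/mem_set; rewrite /circle/= normc_def/= expr0n/= expr1n add0r sqrtr1.
pose i : circle R := exist (fun x => x \in circle R) _ i1.
have hi : homotopic (map_cst i) (map1 R X).
  apply: homotopic_antipodal => x /=; rewrite eq_complex/=.
  by rewrite add0r oner_eq0.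
have -> : map_cst c = mapM (map_cst i) (map_cst i).
  by apply/continuousEP => x; apply/val_inj; rewrite /= cN -expr2 sqr_i.
have -> : map1 R X = mapM (map1 R X) (map1 R X).
  by apply/continuousEP => x; apply/val_inj; rewrite /= mulr1.
exact: homotopicM.
Qed.

End CircleMaps.

Arguments direction {R} z.

(** * Null-homotopic roots and torsion-freeness *)

Section TorsionFree.
Variables (R : realType) (X : topologicalType).
Local Notation C := R[i]^o.
Local Notation map := (continuousType X (circle R)).
Implicit Types f g : map.

Lemma map_eq f g : (forall x, \val (f x) = \val (g x) :> R[i]) -> f = g.
Proof. by move=> fg; apply/continuousEP => x; exact/val_inj/fg. Qed.

Definition has_trivial_root n g :=
  exists2 r : map, homotopic r (map1 R X) & mapX r n = g.

Lemma has_trivial_root1 n : has_trivial_root n (map1 R X).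
Proof.
exists (map1 R X); first exact: homotopic_refl.
by apply: map_eq => x; rewrite val_mapX expr1n.
Qed.

(** The principal root of [g] is continuous and stays in the right half-plane, hence is nowhere
    antipodal to 1. *)
Lemma has_trivial_root_Re_gt0 n g : (0 < n)%N ->
  (forall x, 0 < complex.Re (\val (g x) : R[i])) -> has_trivial_root n g.
Proof.
move=> n0 Reg.
have r0 w : nroot n w != 0 :> R[i] by rewrite -normr_eq0 nroot_norm oner_eq0.
pose u (x : X) : C := nroot n (\val (g x)).
have cu : continuous u.
  move=> x; apply: cvg_nroot; first by rewrite gt_eqF.
  exact: map_val_continuous.
have cr : continuous (direction \o u).
  by apply: direction_continuous => // x; exact: r0.
pose r : map := @mkcts _ _ _ cr.
have rE x : \val (r x) = u x :> R[i].
  apply: etrans (val_direction _) _; first exact: r0.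
  by rewrite /u nroot_norm divr1.
exists r; last by apply: map_eq => x; rewrite val_mapX rE nrootX ?circle_norm.
apply: homotopic_antipodal => x; rewrite rE.
apply/eqP => /(congr1 (@complex.Re R)).
apply/eqP; rewrite gt_eqF// raddfD/= ltr_wpDr ?ler01//.
exact: nroot_Re_gt0.
Qed.

Lemma has_trivial_rootM n f g : has_trivial_root n f -> has_trivial_root n g ->
  has_trivial_root n (mapM f g).
Proof.
move=> [r r1 <-] [s s1 <-]; exists (mapM r s).
  have -> : map1 R X = mapM (map1 R X) (map1 R X).
    by apply: map_eq => x; rewrite /= mulr1.
  exact: homotopicM.
by apply: map_eq => x; rewrite /= !val_mapX exprMn.
Qed.

(** Write [g] as [f] times [g / f]; the quotient is within distance less than 1 of 1, so its real
    part is positive. *)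
Lemma has_trivial_root_near n f g : (0 < n)%N -> has_trivial_root n f ->
  (forall x, `|\val (f x) - \val (g x) : R[i]| < 1) -> has_trivial_root n g.
Proof.
move=> n0 rf fg.
have -> : g = mapM f (mapM g (mapV f)).
  by apply: map_eq => x; rewrite /= mulrCA (mulfV (map_val_neq0 f x)) mulr1.
apply: has_trivial_rootM => //; apply: has_trivial_root_Re_gt0 => // x.
apply: Re_gt0_near1; rewrite /= -[X in _ - X](mulfV (map_val_neq0 f x)).
by rewrite -mulrBl normrM normfV circle_norm invr1 mulr1 distrC; exact: fg.
Qed.

(** The times at which the slice of the homotopy has a trivial root form a clopen set containing 0,
    hence the whole line, since slices at nearby times are uniformly close. *)
Lemma homotopic_has_trivial_root n f : (0 < n)%N -> compact [set: X] ->
  homotopic (map1 R X) f -> has_trivial_root n f.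
Proof.
move=> n0 cX [H [cH H0 H1]].
(* [H] is continuous only within the cylinder; clamping the time gives a map continuous everywhere,
   with the same slices at 0 and 1. *)
pose K (p : X * R) := H (p.1, clamp p.2).
have cK : continuous K.
  apply/continuous_subspace_setT.
  apply: (within_comp (phi := fun p => (p.1, clamp p.2))) cH.
    move=> p; apply: (@cvg_pair _ _ _ _ (nbhs p.1) (nbhs (clamp p.2))).
      exact: cvg_fst.
    by apply: continuous_comp; [exact: cvg_snd|exact: clamp_continuous].
  by move=> p _; exact: clamp_itv.
have cKt t : continuous (fun x => K (x, t)).
  move=> x; apply: (@continuous_comp _ _ _ (fun x => (x, t)) K); last exact: cK.
  by apply: (@cvg_pair _ _ _ _ (nbhs x) (nbhs t));
    [exact: cvg_id|exact: cvg_cst].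
pose slice t : map := @mkcts _ _ _ (cKt t).
have slice_near t : \forall s \near t, forall x,
    `|\val (slice s x) - \val (slice t x) : R[i]| < 1.
  (* Compactness of [X] makes the closeness in [s], local around each point, uniform over [X]. *)
  have /compact_near_coveringP/(_ R (nbhs t)
    (fun s x => `|\val (K (x, s)) - \val (K (x, t)) : R[i]| < 1) _) := cX.
  suff h : forall x, [set: X] x -> \forall x' \near x & s \near t,
      `|\val (K (x', s)) - \val (K (x', t)) : R[i]| < 1.
    by move=> /(_ h); apply: filterS => s h' x; exact: h'.
  move=> x _.
  pose d (p : X * R) : C := \val (K p) - \val (K (p.1, t)).
  have cd : continuous d.
    move=> p; apply: cvgB.
      apply: (@continuous_comp _ (circle R) C K); first exact: cK.
      exact: continuous_circle_val.
    apply: (@continuous_comp _ (circle R) C (fun p => K (p.1, t))).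
      by apply: (@continuous_comp _ _ _ fst (fun x => K (x, t)));
        [exact: cvg_fst|exact: cKt].
    exact: continuous_circle_val.
  have := cd (x, t) [set z | `|z| < 1].
  rewrite /d/= subrr => /(_ _)h; near_simpl; apply: h.
  apply/nbhs_ballP; exists 1 => /=; first exact: ltr01.
  by move=> z; rewrite -ball_normE /ball_/= sub0r normrN.
pose S := [set t | has_trivial_root n (slice t)].
have oS : open S.
  rewrite openE => t St; near=> s.
  apply: (has_trivial_root_near n0 St) => x; rewrite distrC.
  by move: x; near: s; exact: slice_near.
have oSC : open (~` S).
  rewrite openE => t St; near=> s => Ss; apply: St.
  apply: (has_trivial_root_near n0 Ss).
  by near: s; exact: slice_near.
have : connected [set: R] by apply/connected_intervalP.
move=> /(_ S) ST.
have {ST} : S = setT.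
  apply: ST.
  - exists 0; rewrite /S/= (_ : slice 0 = map1 R X).
      exact: has_trivial_root1.
    apply/continuousEP => x; rewrite -H0.
    by change (H (x, clamp 0) = H (x, 0)); rewrite clamp0.
  - by exists S => //; rewrite setTI.
  - by exists S; rewrite ?setTI// -[S]setCK; exact: open_closedC.
move=> /seteqP[_ /(_ 1 I)]; rewrite /S/= (_ : slice 1 = f)//.
apply/continuousEP => x; rewrite -H1.
by change (H (x, clamp 1) = H (x, 1)); rewrite clamp1.
Unshelve. all: by end_near. Qed.

(** The level set of [f] through [y] is closed, and it is open as the locus where a continuous
    function does not vanish. *)
Lemma root_of_unity_cst n f : (0 < n)%N -> connected [set: X] ->
  mapX f n = map1 R X -> forall x y, f x = f y.
Proof.
move=> n0 cX fn x y; apply/val_inj.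
have fX z : \val (f z) ^+ n = 1 :> R[i] by rewrite -val_mapX fn.
set c : R[i] := \val (f y).
have c0 : c != 0 := map_val_neq0 f y.
(* [q z] is the quotient of [f z ^ n - c ^ n = 0] by [f z - c], and [q z] is
   [n * c ^ n.-1] when [f z = c]. *)
pose q (z : X) : C := \sum_(i < n) \val (f z) ^+ (n.-1 - i) * c ^+ i.
have cq : continuous q.
  move=> z; rewrite /q; apply: cvg_big => [|i _]; first exact: add_continuous.
  apply: cvgM; last exact: cvg_cst.
  by apply: cvgX; exact: map_val_continuous.
have qE z : (\val (f z) == c) = (q z != 0).
  apply/idP/idP => [/eqP h|].
    rewrite /q h (eq_bigr (fun=> c ^+ n.-1)) => [|i _]; last first.
      by rewrite -exprD subnK// -ltnS prednK.
    rewrite sumr_const card_ord -mulr_natr mulf_neq0// ?expf_neq0//.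
    by rewrite pnatr_eq0 -lt0n.
  apply: contraNT; rewrite -subr_eq0 => h.
  by have := subrXX (\val (f z)) c n; rewrite !fX subrr => /esym/eqP;
    rewrite mulf_eq0 (negPf h).
pose B := [set z | \val (f z) = c].
suff : B = setT by move=> /seteqP[_ /(_ x I)].
apply: cX; first by exists y.
- exists B; rewrite ?setTI//.
  rewrite (_ : B = q @^-1` (~` [set 0])).
    apply: open_comp => [z _|]; first exact: cq.
    exact/closed_openC/closed_complex1.
  apply/seteqP; split => z /=; first by move=> /eqP; rewrite qE => /eqP.
  by move=> /eqP; rewrite -qE => /eqP.
- exists B; rewrite ?setTI//.
  apply: (@preimage_closed _ C _ [set c]); last exact: closed_complex1.
  by move=> z _; exact: map_val_continuous.
Qed.

Lemma cech_H1_torsion_free : connected [set: X] -> compact [set: X] ->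
  torsion_free (cech_H1 R X).
Proof.
move=> cX kX n a n0; elim/H1_ind: a => f.
rewrite H1_class_mulrn => /H1_classP/homotopic_sym.
move=> /(homotopic_has_trivial_root n0 kX)[r r1 rn].
have s1 : mapX (mapM f (mapV r)) n = map1 R X.
  apply: map_eq => x; rewrite val_mapX /= exprMn exprVn -!val_mapX rn.
  by rewrite mulfV// map_val_neq0.
have hs := root_of_unity_cst n0 cX s1.
apply/H1_classP.
have hsr : homotopic (mapM f (mapV r)) (map1 R X).
  (* A base point is needed to name the constant value; over the empty space all maps coincide. *)
  have [[x0 _]|X0] := pselect ([set: X] !=set0).
    suff -> : mapM f (mapV r) = map_cst X (mapM f (mapV r) x0).
      exact: homotopic_cst.
    by apply/continuousEP => x; exact: hs.
  suff -> : mapM f (mapV r) = map1 R X by exact: homotopic_refl.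
  by apply: map_eq => x; exfalso; apply: X0; exists x.
have -> : f = mapM (mapM f (mapV r)) r.
  by apply: map_eq => x; rewrite /= mulfVK// map_val_neq0.
have -> : map1 R X = mapM (map1 R X) (map1 R X).
  by apply: map_eq => x; rewrite /= mulr1.
exact: homotopicM.
Qed.

End TorsionFree.

(** * Compact and connected subsets as spaces *)

Section SetTypeTopology.
Variables (T : topologicalType) (A : set T).

Lemma set_type_open (B : set A) : open B ->
  exists2 O : set T, open O & B = set_val @^-1` O.
Proof. by move=> [O oO <-]; exists O. Qed.

(** The image of a filter under the inclusion clusters at a point of [A]; opens of the subspace
    being traces, the filter itself clusters there. *)
Lemma set_type_compact : compact A -> compact [set: A].
Proof.
move=> cA F FF _.
have GA : (set_val @ F) A.
  by apply: (@filterS _ F _ setT _ _ filterT) => y _ /=; exact: set_valP.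
have [p [Ap clp]] := cA _ (fmap_proper_filter set_val FF) GA.
exists (exist (fun x => x \in A) p (mem_set Ap)); split => // P N FP.
rewrite nbhsE => -[U [oU Up] UN].
have [O oO UE] := set_type_open oU.
have GP : (set_val @ F) (set_val @` P).
  by apply: (@filterS _ F _ P _ _ FP) => y Py /=; exists y.
have nO : nbhs p O by apply: open_nbhs_nbhs; split => //; move: Up; rewrite UE.
have [q [[y Py yq] Oq]] := clp _ _ GP nO.
by exists y; split => //; apply: UN; rewrite UE /= yq.
Qed.

(** A clopen [B] is the trace of an open [O], and its complement that of an open [O']; so [O] and
    the complement of [O'] have the same trace on [A], which is therefore clopen in [A]. *)
Lemma set_type_connected : connected A -> connected [set: A].
Proof.
move=> cA B [b Bb] [C oC BC] [D cD BD].
have oB : open B by rewrite BC setTI.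
have oBC : open (~` B) by rewrite BD setTI; exact: closed_openC.
have [O oO BO] := set_type_open oB.
have [O' oO' BO'] := set_type_open oBC.
have h : A `&` O = A.
  apply: cA.
  - by exists (set_val b); split; [exact: set_valP|move: Bb; rewrite BO].
  - by exists O.
  - exists (~` O'); first exact: open_closedC.
    apply/seteqP; split => x [Ax].
      move=> Ox; split => // O'x.
      have : (~` B) (exist (fun x => x \in A) x (mem_set Ax)) by rewrite BO'.
      by apply; rewrite BO.
    move=> O'x; split => //; apply: contrapT => Ox; apply: O'x.
    have : (~` B) (exist (fun x => x \in A) x (mem_set Ax)) by rewrite BO.
    by rewrite BO'.
rewrite -subTset => y _; rewrite BO /=.
by have := set_valP y; rewrite -{1}h => -[].
Qed.

End SetTypeTopology.

(** Lets the Hausdorff property of a space be checked coordinate by coordinate. *)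
Lemma cluster_nbhs_continuous (T U : topologicalType) (f : T -> U) (p q : T) :
  hausdorff_space U -> continuous f -> cluster (nbhs p) q -> f p = f q.
Proof.
move=> hU cf pq; apply: hU => A B nA nB.
by have [y [Ay By]] := pq _ _ (cf p _ nA) (cf q _ nB); exists (f y).
Qed.

(** * The n-fold covering given by the roots of [f] *)

Section Cover.
Variables (R : realType) (X : topologicalType).
Local Notation C := R[i]^o.
Local Notation map := (continuousType X (circle R)).
Hypothesis X_continuum : continuum X.
Variables (f : map) (n : nat).
Hypothesis n_gt0 : (0 < n)%N.

Definition root_cover : set (X * C) :=
  [set p | p.2 ^+ n = \val (f p.1) :> R[i]].

Lemma root_cover_norm p : root_cover p -> `|p.2 : R[i]| = 1.
Proof.
move=> pY; apply/eqP; rewrite -(pexpr_eq1 n_gt0)// -normrX pY.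
by rewrite circle_norm.
Qed.

Lemma root_cover_closed : closed root_cover.
Proof.
pose d (p : X * C) : C := p.2 ^+ n - \val (f p.1).
have cd : continuous d.
  move=> p; apply: cvgB; first by apply: cvgX; exact: cvg_snd.
  by apply: (@continuous_comp _ X C fst (fun x => \val (f x)));
    [exact: cvg_fst|exact: map_val_continuous].
rewrite (_ : root_cover = d @^-1` [set 0]).
  apply: preimage_closed => [p _|]; first exact: cd.
  exact: closed_complex1.
apply/seteqP; split => p; rewrite /root_cover/d/=.
  by move=> ->; rewrite subrr.
by move/subr0_eq.
Qed.

Lemma root_cover_compact : compact root_cover.
Proof.
have [_ kX _] := X_continuum.
apply: subclosed_compact (compact_setX kX (@circle_compact R)) _.
  exact: root_cover_closed.
by move=> p /root_cover_norm p1; split.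
Qed.

(** Closedness is asked in the ambient product, which for subsets of the closed [root_cover] is the
    same as relative closedness. *)
Definition clopen_part (U : set (X * C)) :=
  closed U /\ exists2 O, open O & U = root_cover `&` O.

(** The projection of [U] is closed by compactness and open because the covering has local sections;
    [X] is connected. *)
Lemma clopen_part_onto U : clopen_part U -> U !=set0 ->
  forall x, exists z, U (x, z).
Proof.
move=> [cU [O oO UE]] [p0 Up0]; have [cX kX hX] := X_continuum.
suff : fst @` U = setT.
  by move=> /seteqP[_ h] x; have [[? z] ? /= <-] := h x I; exists z.
apply: cX; first by exists p0.1, p0.
- exists (fst @` U); rewrite ?setTI// openE => _ [[x0 z0] Uxz <-] /=.
  (* Local section [s] through [(x0, z0)]: [w] is near 1 around [x0], where its principal root is
     available to correct [z0]. *)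
  pose w (x : X) : C := \val (f x) / \val (f x0).
  pose s (x : X) : X * C := (x, z0 * nroot n (w x)).
  have w1 : w x0 = 1 by rewrite /w mulfV// map_val_neq0.
  have cw : w x @[x --> x0] --> (1 : C).
    by rewrite -w1; apply: cvgM; [exact: map_val_continuous|exact: cvg_cst].
  have cs : s x @[x --> x0] --> (x0, z0 : C).
    apply: (@cvg_pair _ _ _ _ (nbhs x0) (nbhs (z0 : C))); first exact: cvg_id.
    rewrite (_ : nbhs (z0 : C) = nbhs (z0 * nroot n 1 : C)); last first.
      by rewrite nroot1 mulr1.
    apply: cvgM; first exact: cvg_cst.
    by apply: cvg_nroot => //=; exact: oner_neq0.
  have Oxz : O (x0, z0) by move: Uxz; rewrite UE => -[].
  have nO : \forall x \near x0, O (s x).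
    by apply: cs; apply: open_nbhs_nbhs.
  have nw : \forall x \near x0, `|w x - 1 : R[i]| < 1.
    apply: (cw [set z : C | `|z - 1 : R[i]| < 1]); apply/nbhs_ballP.
    exists 1 => /=; first exact: ltr01.
    by move=> z; rewrite -ball_normE /ball_/= distrC.
  near=> x; exists (s x) => //; rewrite UE; split; last by near: x.
  rewrite /root_cover/= exprMn nrootX//.
  - have : root_cover (x0, z0) by move: Uxz; rewrite UE => -[].
    by rewrite /root_cover/= => ->; rewrite /w mulrC mulfVK// map_val_neq0.
  - by rewrite /w normrM normfV !circle_norm invr1 mulr1.
  - by apply: Re_gt0_near1; near: x.
- exists (fst @` U); rewrite ?setTI//; apply: compact_closed => //.
  apply: continuous_compact.
    by apply: continuous_subspaceT => p; exact: cvg_fst.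
  apply: subclosed_compact root_cover_compact _ => //.
  by rewrite UE; exact: subIsetl.
Unshelve. all: by end_near. Qed.

(* A clopen part meeting the fibre over [x0] in as few points as possible is
   connected, as each of its two halves would meet that fibre. *)
Lemma connected_clopen_part (x0 : X) :
  exists V, [/\ clopen_part V, V !=set0 & connected V].
Proof.
(* The fibre over [x0] is finite: its points are roots of ['X^n - f x0]. *)
have [rs rsP] : exists rs : seq R[i],
    forall z, z ^+ n = \val (f x0) -> z \in rs.
  pose p : {poly R[i]} := 'X^n - (\val (f x0) : R[i])%:P.
  have p0 : p != 0 by rewrite -size_poly_eq0 size_XnsubC.
  have [rs pE] := closed_field_poly_normal p.
  exists rs => z zn; have : root p z by rewrite /root !hornerE zn subrr.
  by rewrite pE rootZ ?lead_coef_eq0// root_prod_XsubC.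
pose c (U : set (X * C)) := count (fun z : R[i] => `[< U (x0, z) >]) rs.
suff h m : forall U, (c U < m)%N -> clopen_part U -> U !=set0 ->
    exists V, [/\ clopen_part V, V !=set0 & connected V].
  apply: (h (c root_cover).+1 root_cover) => //.
    split; first exact: root_cover_closed.
    by exists setT; rewrite ?setIT//; exact: openT.
  exists (x0, n.-root (\val (f x0) : R[i])); rewrite /root_cover/=.
  by rewrite rootCK.
elim: m => [//|m IH] U cU Up U0.
have [cnU|] := pselect (connected U); first by exists U.
(* Disconnectedness yields a nonempty [B], different from [U], that both an open [O] and a closed
   [D] cut out of [U]. *)
move=> /existsNP[B /not_implyP[B0]].
move=> /not_implyP[[O oO BO] /not_implyP[[D cD BD] BU]].
have [clU [O' oO' UO']] := Up.
have Bp : clopen_part B.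
  split; first by rewrite BD; exact: closedI.
  by exists (O' `&` O); [exact: openI|rewrite BO UO' setIA].
pose B' := U `\` B.
have B'p : clopen_part B'.
  split.
    rewrite (_ : B' = U `&` ~` O).
      by apply: closedI => //; exact: open_closedC.
    by rewrite /B' BO setDE setCI setIUr setICr set0U.
  exists (O' `&` ~` D); first by apply: openI => //; exact: closed_openC.
  by rewrite /B' BD setDE setCI setIUr setICr set0U UO' setIA.
have BsU : B `<=` U by rewrite BO; exact: subIsetl.
have B'0 : B' !=set0.
  apply/set0P/eqP; rewrite /B' setD_eq0 => UB; apply: BU.
  exact/seteqP.
have [z [Uz Bz]] := clopen_part_onto B'p B'0 x0.
apply: (IH B) => //; suff h : (c B < c U)%N by exact: leq_trans h cU.
have zrs : z \in rs by apply: rsP; move: Uz; rewrite UO' => -[].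
(* Split [rs] at [z]: this entry counts for [U] but not for [B], and elsewhere [B] counts no more
   than [U]. *)
rewrite /c -(cat_take_drop (index z rs) rs) (drop_nth z) ?index_mem//.
rewrite nth_index//.
rewrite !count_cat/= (asboolT Uz) (asboolF Bz) add0n add1n addnS ltnS.
by apply: leq_add; apply: sub_count => y /asboolP/BsU/asboolP.
Qed.

End Cover.

(** * Norms, pullbacks and the root formula in function algebras *)

Section FunctionAlgebra.
Variable R : realType.
Local Notation C := R[i]^o.

Lemma cfun_norm_ge0 (Z : topologicalType) (g : cfun_algebra R Z) :
  0 <= cs_norm g.
Proof.
rewrite /= /cfun_norm; set E := (X in sup X).
(* Without a supremum, [sup] takes the default value 0, which satisfies the bound too. *)
have [sE|/sup_out ->//] := pselect (has_sup E).
have [[y Ey] ubE] := sE; apply: le_trans (ub_le_sup ubE Ey).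
move: Ey => [x _ <-].
by have := normr_ge0 (g x : R[i]); rewrite normc_real ler0c.
Qed.

Lemma cfun_norm_le (Z : topologicalType) (g : cfun_algebra R Z) (c : R) :
  0 <= c -> (forall x, `|g x : R[i]| <= c%:C) -> cs_norm g <= c.
Proof.
move=> c0 gc; rewrite /= /cfun_norm; set E := (X in sup X).
have [sE|/sup_out ->//] := pselect (has_sup E).
have [E0 _] := sE; apply: ge_sup E0 _ => _ [x _ <-].
by rewrite -lecR -normc_real.
Qed.

Lemma le_cfun_norm (Z : topologicalType) (g : cfun_algebra R Z) (x : Z) :
  compact [set: Z] -> `|g x : R[i]| <= (cs_norm g)%:C.
Proof.
move=> cZ; rewrite normc_real lecR.
have : has_sup (range (fun x => complex.Re `|g x : R[i]|)).
  apply: compact_has_sup; first by exists (complex.Re `|g x : R[i]|), x.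
  apply: continuous_compact cZ; apply: continuous_subspaceT => y.
  apply: (@continuous_comp _ C R (fun y => `|g y|) (@complex.Re R)).
    apply: (@cvg_norm R[i] C).
    exact: (@cts_fun _ _ (g : continuousType Z C)).
  exact: continuous_Re.
move=> [_ ub]; exact: ub_le_sup ub _ (imageT _ x).
Qed.

Lemma models_Tconn_cfun (Y : topologicalType) :
  continuum Y -> models_Tconn (cfun_algebra R Y).
Proof.
move=> cY; exists Y => //; exists id; first by split.
by exists id.
Qed.

Section Pullback.
Variables (X Y : topologicalType) (p : Y -> X).
Hypothesis cp : continuous p.

Lemma pullback_continuous (g : continuousType X C) : continuous (g \o p).
Proof. by move=> y; apply: continuous_comp; [exact: cp|exact: cts_fun]. Qed.

Definition pullback (g : cfun_algebra R X) : cfun_algebra R Y :=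
  @mkcts _ _ _ (@pullback_continuous g).

(** Surjectivity of [p] gives [g] and its pullback the same set of values, hence the same norm. *)
Lemma pullback_embedding :
  (forall x, exists y, p y = x) -> is_embedding pullback.
Proof.
move=> surj; split; try by move=> *; apply/continuousEP.
move=> g; rewrite /= /cfun_norm; congr sup; apply/seteqP.
split => _ [y _ <-] /=; first by exists (p y).
by have [z <-] := surj y; exists z.
Qed.

End Pullback.

Definition pow_term (V : Type) (n : nat) (v : V) : cs_term R V :=
  iter n (TMul (TVar R v)) (TOne R V).

Lemma term_eval_pow (Z : topologicalType) (V : Type)
    (e : V -> cfun_algebra R Z) n v z :
  (term_eval e (pow_term n v) : continuousType Z C) z =
  (e v : continuousType Z C) z ^+ n :> R[i].
Proof.
elim: n => [//|n IH]; rewrite exprS -IH.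
by change (iter n.+1 _ _) with (TMul (TVar R v) (pow_term n v)).
Qed.

(** The formula [|| x ^ n - y ||], with [x] the quantified variable and [y] the parameter. *)
Definition root_formula (n : nat) : qf_formula R ('I_1 + 'I_1) :=
  QNorm (TAdd (pow_term n (inl ord0)) (TScale (-1) (TVar R (inr ord0)))).

Lemma qf_eval_root_formula (Z : topologicalType) n
    (a b : 'I_1 -> cfun_algebra R Z) :
  exists2 g : cfun_algebra R Z,
    qf_eval (assign a b) (root_formula n) = cs_norm g &
    forall z, (g : continuousType Z C) z =
      (a ord0 : continuousType Z C) z ^+ n -
      (b ord0 : continuousType Z C) z :> R[i].
Proof.
eexists; first by [].
move=> z; rewrite -[X in _ = _ + X]mulN1r.
exact: (congr1 (fun t : R[i] => t + -1 * (b ord0 : continuousType Z C) z)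
  (term_eval_pow (assign a b) n (inl ord0) z)).
Qed.

End FunctionAlgebra.

(** * Approximate roots by existential closedness, and divisibility *)

Section Divisible.
Variables (R : realType) (X : topologicalType).
Local Notation C := R[i]^o.
Local Notation map := (continuousType X (circle R)).

Lemma root_cover_continuum (f : map) n (V : set (X * C)) :
  continuum X -> (0 < n)%N -> clopen_part f n V -> connected V ->
  continuum (V : Type).
Proof.
move=> cX n0 [clV [O _ VO]] cV; split.
- exact: set_type_connected.
- apply: set_type_compact.
  apply: (subclosed_compact clV (root_cover_compact cX n0)).
  by rewrite VO; exact: subIsetl.
- have [_ _ hX] := cX.
  have cval : continuous (set_val : V -> X * C) by exact: initial_continuous.
  move=> p q pq; apply: val_inj.
  have e1 := cluster_nbhs_continuous (f := fun y : V => (set_val y).1) hX _ pq.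
  have e2 := @cluster_nbhs_continuous _ C (fun y : V => (set_val y).2) _ _
    (@norm_hausdorff _ _) _ pq.
  rewrite [LHS]surjective_pairing [RHS]surjective_pairing; congr pair.
    by apply: e1 => y; apply: continuous_comp; [exact: cval|exact: cvg_fst].
  by apply: e2 => y; apply: continuous_comp; [exact: cval|exact: cvg_snd].
Qed.

Lemma coexistentially_closed_approx_root (f : map) n : [set: X] !=set0 ->
  coexistentially_closed R X -> (0 < n)%N ->
  exists a : continuousType X C, forall x, `|a x ^+ n - \val (f x) : R[i]| < 1.
Proof.
move=> [x0 _] [cX [_ ecX]] n0.
have [V [Vp V0 cV]] := connected_clopen_part cX f n0 x0.
have cY := root_cover_continuum cX n0 Vp cV.
have [_ kX _] := cX.
set Y := (V : Type) : topologicalType in cY.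
have cval : continuous (set_val : Y -> X * C) by exact: initial_continuous.
have cp : continuous (fun y : Y => (set_val y).1).
  by move=> y; apply: continuous_comp; [exact: cval|exact: cvg_fst].
have cq : continuous (fun y : Y => (set_val y).2 : C).
  by move=> y; apply: continuous_comp; [exact: cval|exact: cvg_snd].
have surj x : exists y : Y, (set_val y).1 = x.
  have [z Vz] := clopen_part_onto cX n0 Vp V0 x.
  by exists (exist (fun p => p \in V) (x, z) (mem_set Vz)).
pose b : 'I_1 -> cfun_algebra R X :=
  fun=> @mkcts _ _ _ (@map_val_continuous _ _ f).
(* Radius 1 suffices, as points of the covering have second coordinate of modulus 1. *)
pose r : 'I_1 -> nat := fun=> 1%N.
pose phi := root_formula R n.
pose ball1 (Z : topologicalType) :=
  [set a : 'I_1 -> cfun_algebra R Z | forall i, cs_norm (a i) <= (r i)%:R].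
have lb0 (Z : topologicalType) (e : 'I_1 -> cfun_algebra R Z) :
    lbound [set qf_eval (assign a e) phi | a in ball1 Z] 0.
  move=> _ [a _ <-]; have [g -> _] := qf_eval_root_formula n a e.
  exact: cfun_norm_ge0.
have VY (y : Y) : root_cover f n (set_val y).
  by have [_ [O _ VO]] := Vp; have := set_valP y; rewrite {1}VO => -[].
pose b' := pullback cp \o b.
have infY : inf_eval r phi b' = 0.
  (* The second projection is an exact root of the pulled-back [f], so the infimum over [Y] is
     attained with value 0. *)
  pose a : 'I_1 -> cfun_algebra R Y := fun=> @mkcts _ _ _ cq.
  have a1 i : cs_norm (a i) <= (r i)%:R.
    apply: cfun_norm_le => // y.
    by rewrite [X in X <= _](root_cover_norm n0 (VY y)).
  apply/le_anti/andP; split; last first.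
    by apply: lb_le_inf (lb0 _ _); exists (qf_eval (assign a b') phi), a.
  apply: (@le_trans _ _ (qf_eval (assign a b') phi)).
    by apply: ge_inf; [exists 0; exact: lb0|exists a].
  have [g -> gE] := qf_eval_root_formula n a b'.
  apply: cfun_norm_le => // y; rewrite gE.
  rewrite [X in `|X|](_ : _ = 0) ?normr0//.
  by apply/eqP; rewrite subr_eq0; apply/eqP; exact: VY.
have emb := @pullback_embedding R _ _ _ cp surj.
have := ecX _ _ (models_Tconn_cfun R cY) emb 1%N 1%N r phi b.
rewrite [RHS]infY => infX.
set E := [set qf_eval (assign a b) phi | a in ball1 X].
(* The zero function lies in the ball, so [E] is nonempty and [inf E], equal to 0, is approached
   within 1 by an actual value. *)
have hE : has_inf E.
  split; last by exists 0; exact: lb0.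
  pose a : 'I_1 -> cfun_algebra R X := fun=> cs_zero _.
  exists (qf_eval (assign a b) phi), a => // i.
  by apply: cfun_norm_le => // x; rewrite [X in `|X|](_ : _ = 0) ?normr0.
have [_ [a _ <-]] := inf_adherent ltr01 hE.
rewrite [inf E]infX add0r.
have [g -> gE] := qf_eval_root_formula n a b => g1.
exists (a ord0) => x; rewrite -gE.
by rewrite (le_lt_trans (le_cfun_norm _ _ kX))// ltcR.
Qed.

Lemma cech_H1_divisible : coexistentially_closed R X -> divisible (cech_H1 R X).
Proof.
move=> hX n a n0; elim/H1_ind: a => f.
have [X0|X0] := pselect ([set: X] !=set0); last first.
  exists (H1_class f); rewrite H1_class_mulrn.
  congr H1_class; apply: map_eq => x.
  by exfalso; apply: X0; exists x.
have [a af] := coexistentially_closed_approx_root f X0 hX n0.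
(* At a zero of [a] the distance from [a x ^ n] to [f x] would be exactly 1. *)
have a0 x : (a x : C) != 0.
  apply: contraTneq (af x) => ->.
  by rewrite expr0n gtn_eqF// sub0r normrN circle_norm ltxx.
have cd : continuous (direction \o a).
  by apply: direction_continuous => // x; exact: cts_fun.
pose y : map := @mkcts _ _ _ cd.
exists (H1_class y); rewrite H1_class_mulrn; apply/H1_classP.
apply: homotopic_antipodal => x; rewrite val_mapX.
rewrite [X in X ^+ n](val_direction (a0 x)).
apply/eqP => /eqP; rewrite addr_eq0 => /eqP e.
(* Were the n-th power of the direction of [a x] antipodal to [f x], the distance from [a x ^ n] to
   [f x] would be [|a x| ^ n + 1], contradicting the bound 1. *)
have aN : a x ^+ n = - (`|a x : R[i]| ^+ n * \val (f x)) :> R[i].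
  by rewrite -mulrN -e expr_div_n mulrC divfK// expf_neq0// normr_eq0.
have := af x; rewrite aN -opprD normrN -[X in _ + X]mul1r -mulrDl.
rewrite normrM circle_norm mulr1.
rewrite ger0_norm ?addr_ge0 ?exprn_ge0//.
by rewrite gtrDr => /lt_geF; rewrite exprn_ge0.
Qed.

End Divisible.

Theorem theorem4p12 (R : realType) (X : topologicalType)
    (hX : coexistentially_closed R X) :
  torsion_free (cech_H1 R X) /\ divisible (cech_H1 R X).
Proof.
have [[cX kX _] _] := hX.
by split; [exact: cech_H1_torsion_free|exact: cech_H1_divisible].
Qed.
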